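(* Let $\Omega$ be a compact metric space, let $K$ be a kernel on $\Omega\times\Omega$, and suppose that there exists a $K$-invariant measure $\mu\in\mathbb P(\Omega)$, i.e. $U_K^\mu(x)=I_K(\mu)$ for every $x\in\Omega$. If $K$ is conditionally positive definite, then $K$ is positive definite up to an additive constant. If $K$ is conditionally strictly positive definite, then $K$ is strictly positive definite up to an additive constant.
   Context: A kernel on $\Omega\times\Omega$ is a continuous symmetric function $K:\Omega\times\Omega\to\mathbb R$. $\mathcal M(\Omega)$ is the set of finite regular signed Borel measures on $\Omega$; $\mathbb P(\Omega)$ the Borel probability measures; $\mathcal Z(\Omega)$ the set of $\nu\in\mathcal M(\Omega)$ with $\nu(\Omega)=0$. $I_K(\mu)=\int_\Omega\int_\Omega K(x,y)\,d\mu(x)\,d\mu(y)$ and $U_K^\mu(x)=\int_\Omega K(x,y)\,d\mu(y)$. $K$ is positive definite (resp. conditionally positive definite) if $I_K(\nu)\ge0$ for every $\nu\in\mathcal M(\Omega)$ (resp. every $\nu\in\mathcal Z(\Omega)$); the strict versions additionally require that, for $\nu$ in the respective class, $I_K(\nu)=0$ only if $\nu=0$. $K$ is (strictly) positive definite up to an additive constant if $K+C$ is (strictly) positive definite for some $C\in\mathbb R$. *)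

(* Defs.v *)
From HB Require Import structures.
From mathcomp Require Import all_boot all_order all_algebra.
From mathcomp Require Import all_classical all_reals all_analysis.

Set Implicit Arguments.
Unset Strict Implicit.
Unset Printing Implicit Defensive.

Import Order.TTheory GRing.Theory Num.Theory.
Import numFieldNormedType.Exports.

Local Open Scope classical_set_scope.
Local Open Scope ring_scope.

(* The library's measurable types are pointed, and it has no join of [Pointed]
   and [Metric]. *)
#[short(type="pointedMetricType")]
HB.structure Definition PointedMetric (R : numDomainType) :=
  {T of Pointed T & Metric R T}.

Notation borel T := (g_sigma_algebraType (@open T)).

Section charge_integral.
Context d (T : measurableType d) (R : realType).
Variable nu : {charge set T -> \bar R}.

(* By [Hahn_decomposition_uniq] nothing below depends on the choice of the
   decomposition. *)
Definition hahn_pos : set T := sval (cid (Hahn_decomposition nu)).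

Definition hahn_neg : set T := sval (cid (svalP (cid (Hahn_decomposition nu)))).

Definition hahnP : hahn_decomposition nu hahn_pos hahn_neg :=
  svalP (cid (svalP (cid (Hahn_decomposition nu)))).

Definition charge_total_variation : set T -> \bar R := charge_variation hahnP.

Definition charge_integral (f : T -> R) : R :=
  \int[jordan_pos hahnP]_x f x - \int[jordan_neg hahnP]_x f x.

End charge_integral.

Definition charge_regular (R : realType) (T : ptopologicalType)
    (nu : {charge set (borel T) -> \bar R}) : Prop :=
  forall A : set (borel T), measurable A ->
    charge_total_variation nu A =
      ereal_inf [set charge_total_variation nu U |
                 U in [set U : set T | open U /\ A `<=` U]]
    /\ charge_total_variation nu A =
      ereal_sup [set charge_total_variation nu C |
                 C in [set C : set T | compact C /\ C `<=` A]].

Section kernels.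
Context (R : realType) (T : ptopologicalType).
Implicit Types (K : T * T -> R) (nu : {charge set (borel T) -> \bar R}).

Definition is_kernel K : Prop :=
  continuous K /\ forall x y : T, K (x, y) = K (y, x).

Definition potential K nu (x : T) : R :=
  charge_integral nu (fun y : borel T => K (x, y)).

Definition energy K nu : R :=
  charge_integral nu
    (fun y : borel T => charge_integral nu (fun x : borel T => K (x, y))).

Definition zero_mass nu : Prop := nu setT = 0%E.

(* Charges carry junk values on non-measurable sets. *)
Definition charge_null nu : Prop :=
  forall A : set (borel T), measurable A -> nu A = 0%E.

Definition pos_def K : Prop :=
  forall nu, charge_regular nu -> 0 <= energy K nu.

Definition strict_pos_def K : Prop :=
  pos_def K /\
  forall nu, charge_regular nu -> energy K nu = 0 -> charge_null nu.

Definition cond_pos_def K : Prop :=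
  forall nu, charge_regular nu -> zero_mass nu -> 0 <= energy K nu.

Definition cond_strict_pos_def K : Prop :=
  cond_pos_def K /\
  forall nu, charge_regular nu -> zero_mass nu ->
    energy K nu = 0 -> charge_null nu.

Definition pos_def_up_to_constant K : Prop :=
  exists C : R, pos_def (fun p => K p + C).

Definition strict_pos_def_up_to_constant K : Prop :=
  exists C : R, strict_pos_def (fun p => K p + C).

Definition invariant_measure K (mu : probability (borel T) R) : Prop :=
  forall x : T, potential K (charge_of_finite_measure mu) x =
                energy K (charge_of_finite_measure mu).

End kernels.

(* Main.v *)
Require Import Defs.
From mathcomp Require Import all_boot all_order all_algebra.
From mathcomp Require Import all_classical all_reals all_analysis.
From mathcomp Require Import measurable_realfun ring lra.

(** Let [mu] be the invariant probability measure and [c] its energy. Since the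
potential of [mu] is the constant [c], the bilinear form attached to [K] pairs
[mu] with any charge [nu] to [c * nu(T)]. Subtracting from [nu] the multiple
[nu(T) mu] that carries its whole mass gives a charge of mass zero, and
expanding the square yields
[[
  I_K(nu - nu(T) mu) = I_K(nu) - c * nu(T)^2     (energy_neutralize).
]]
On the other hand [I_(K + C)(nu) = I_K(nu) + C * nu(T)^2] ([energy_add_cst]).
With [C = - c] the right-hand sides agree, so conditional positive definiteness
of [K] gives positive definiteness of [K - c]. With [C = 1 - c] the energy of
[nu] becomes [I_K(nu - nu(T) mu) + nu(T)^2], a sum of two nonnegative terms; if
it vanishes then [nu] itself has mass zero and [I_K(nu) = 0], and the
conditional strictness applies to [nu].

Three facts make this computation legitimate.
- The integral against a charge, defined through the Jordan decomposition of
  that charge, is linear in the charge. The Jordan decomposition is not linear,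
  but the integral can be computed from any way of writing the charge as a
  difference of finite measures ([charge_integral_diff]).
- Iterated integrals against two charges can be exchanged
  ([charge_integral_swap]). Fubini needs [K] to be measurable for the product
  of the Borel sigma-algebras, and this is where second countability of a
  compact metric space enters ([open_product_borel]).
- The conditional hypothesis speaks only of regular charges, so
  [nu - nu(T) mu] has to be shown regular; in fact every charge on a compact
  metric space is ([charge_regular_compact]). *)

Import Order.TTheory GRing.Theory Num.Theory.
Import numFieldNormedType.Exports.
Local Open Scope classical_set_scope.
Local Open Scope ring_scope.

Set Implicit Arguments.
Unset Strict Implicit.
Unset Printing Implicit Defensive.

(** * Bounded measurable functions and finite measures *)

Section bounded_measurable.
Context d (T : measurableType d) (R : realType).
Implicit Types (f g : T -> R) (m : {measure set T -> \bar R}).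

(** A class of integrands that is integrable for every finite measure at once,
    so that no integrability hypothesis depends on a Jordan decomposition. *)
Definition bounded_measurable f : Prop :=
  measurable_fun setT f /\ exists M : R, forall x, `|f x| <= M.

Lemma bounded_measurable_cst (c : R) : bounded_measurable (fun=> c).
Proof. by split; [exact: measurable_cst | exists `|c|]. Qed.

Lemma bounded_measurableD f g : bounded_measurable f -> bounded_measurable g ->
  bounded_measurable (fun x => f x + g x).
Proof.
move=> [mf [M fM]] [mg [N gN]]; split; first exact: measurable_funD.
by exists (M + N) => x; rewrite (le_trans (ler_normD _ _))// lerD.
Qed.

Lemma bounded_measurableN f : bounded_measurable f ->
  bounded_measurable (fun x => - f x).
Proof.
move=> [mf [M fM]]; split; first exact: measurableT_comp.
by exists M => x; rewrite normrN.
Qed.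

Lemma bounded_measurable_integrable m f :
  (m setT < +oo)%E -> bounded_measurable f -> m.-integrable setT (EFin \o f).
Proof.
move=> mfin [mf [M fM]]; apply: measurable_bounded_integrable => //.
exists M; split; first exact: num_real.
by move=> N MN x _; apply: (le_trans (fM x)); exact: ltW.
Qed.

Lemma measure_add_lty (m1 m2 : {measure set T -> \bar R}) :
  (m1 setT < +oo)%E -> (m2 setT < +oo)%E -> (measure_add m1 m2 setT < +oo)%E.
Proof. by move=> fin1 fin2; rewrite measure_addE lte_add_pinfty. Qed.

Lemma Rintegral_measure_add (m1 m2 : {measure set T -> \bar R}) f :
  (m1 setT < +oo)%E -> (m2 setT < +oo)%E -> bounded_measurable f ->
  \int[measure_add m1 m2]_x f x = \int[m1]_x f x + \int[m2]_x f x.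
Proof.
move=> fin1 fin2 bf.
have int1 := bounded_measurable_integrable fin1 bf.
have int2 := bounded_measurable_integrable fin2 bf.
rewrite /Rintegral integral_measure_add//.
by rewrite fineD//; exact: integrable_fin_num.
Qed.

Lemma Rintegral_mscale (k : {nonneg R}) m f :
  (m setT < +oo)%E -> bounded_measurable f ->
  \int[mscale k m]_x f x = k%:num * \int[m]_x f x.
Proof.
move=> mfin bf.
have intf := bounded_measurable_integrable mfin bf.
have mf := measurable_int m intf.
rewrite /Rintegral -[k%:num]/(fine k%:num%:E) -fineM//; last first.
  exact: integrable_fin_num.
congr fine; rewrite integralE ge0_integral_mscale//; last first.
  exact: measurable_funepos.
rewrite ge0_integral_mscale//; last exact: measurable_funeneg.
rewrite -muleBr//; first by rewrite -integralE.
apply: fin_num_adde_defr; exact: integrable_pos_fin_num.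
Qed.

End bounded_measurable.

(** * Linearity of the integral against a charge *)

Lemma fin_num_sub_add (R : realType) (x y u v : \bar R) :
  x \is a fin_num -> y \is a fin_num -> u \is a fin_num -> v \is a fin_num ->
  (x - y = u - v -> x + v = y + u)%E.
Proof.
move=> /fineK <- /fineK <- /fineK <- /fineK <-; rewrite -!EFinB -!EFinD.
by move=> [] xyuv; congr EFin; lra.
Qed.

Lemma fin_num_add_scale (R : realType) (x y z : \bar R) (c p n : R) :
  x \is a fin_num -> y \is a fin_num -> z \is a fin_num -> c = p - n ->
  ((x - y) + c%:E * z = (x + p%:E * z) - (y + n%:E * z))%E.
Proof.
move=> /fineK <- /fineK <- /fineK <- ->.
by rewrite -!EFinM -!EFinB -!EFinD; congr EFin; ring.
Qed.

Section charge_integral_linear.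
Context d (T : measurableType d) (R : realType).
Implicit Types (f g : T -> R) (nu : {charge set T -> \bar R})
  (mu : {finite_measure set T -> \bar R}).

Lemma finite_measure_ltey mu : (mu setT < +oo)%E.
Proof. by rewrite ltey_eq fin_num_measure. Qed.

Lemma finite_measure_integrable mu f :
  bounded_measurable f -> mu.-integrable setT (EFin \o f).
Proof. exact/bounded_measurable_integrable/finite_measure_ltey. Qed.

Lemma jordan_decompE nu A : measurable A ->
  nu A = (jordan_pos (hahnP nu) A - jordan_neg (hahnP nu) A)%E.
Proof.
by move=> mA; rewrite (jordan_decomp (hahnP nu) mA) /cadd/= cscaleN1.
Qed.

(** If [P - N = al - be] then [P + be = N + al], an identity between measures,
    against which [f] may be integrated. *)
Lemma charge_integral_diff nu (al be : {measure set T -> \bar R}) f :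
  (al setT < +oo)%E -> (be setT < +oo)%E ->
  (forall A, measurable A -> nu A = al A - be A)%E -> bounded_measurable f ->
  charge_integral nu f = \int[al]_x f x - \int[be]_x f x.
Proof.
move=> alfin befin nuE bf; rewrite /charge_integral.
set P := jordan_pos _; set N := jordan_neg _.
suff : \int[measure_add P be]_x f x = \int[measure_add N al]_x f x.
  rewrite !Rintegral_measure_add ?finite_measure_ltey//; lra.
congr fine; apply: eq_measure_integral => A mA _.
rewrite [LHS](measure_addE P be A) [RHS](measure_addE N al A).
move: (nuE _ mA); rewrite (jordan_decompE _ mA) -/P -/N.
have Pf : P A \is a fin_num by exact: fin_num_measure.
have Nf : N A \is a fin_num by exact: fin_num_measure.
have af : al A \is a fin_num by exact: (lty_fin_num_fun alfin).
have ef : be A \is a fin_num by exact: (lty_fin_num_fun befin).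
exact: fin_num_sub_add.
Qed.

Lemma charge_integral_measure mu f : bounded_measurable f ->
  charge_integral (charge_of_finite_measure mu) f = \int[mu]_x f x.
Proof.
move=> bf; rewrite (@charge_integral_diff _ mu mzero) ?finite_measure_ltey//.
- by rewrite /Rintegral integral_measure_zero subr0.
- by move=> A mA; rewrite /mzero sube0.
Qed.

(** Splitting [c] into its positive and negative parts writes [nu + c mu] as a
    difference of two finite measures, whatever the sign of [c]. *)
Lemma charge_integral_add_scale nu mu (c : R) f : bounded_measurable f ->
  charge_integral (cadd nu (cscale c (charge_of_finite_measure mu))) f =
  charge_integral nu f + c * charge_integral (charge_of_finite_measure mu) f.
Proof.
move=> bf; rewrite charge_integral_measure//.
have p0 : 0 <= Num.max c 0 by rewrite le_max lexx orbT.
have n0 : 0 <= Num.max (- c) 0 by rewrite le_max lexx orbT.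
have cE : c = Num.max c 0 - Num.max (- c) 0.
  by rewrite /Num.max; do 2 case: ifP => //; lra.
pose p := NngNum p0; pose n := NngNum n0.
pose al := measure_add (jordan_pos (hahnP nu)) (mscale p mu).
pose be := measure_add (jordan_neg (hahnP nu)) (mscale n mu).
rewrite (@charge_integral_diff _ al be)//.
- rewrite !Rintegral_measure_add ?finite_measure_ltey//.
  rewrite !Rintegral_mscale ?finite_measure_ltey// [in RHS]cE.
  by rewrite /charge_integral/=; ring.
- by apply: measure_add_lty; exact: finite_measure_ltey.
- by apply: measure_add_lty; exact: finite_measure_ltey.
- move=> A mA.
  transitivity ((jordan_pos (hahnP nu) A + p%:num%:E * mu A) -
                (jordan_neg (hahnP nu) A + n%:num%:E * mu A))%E; last first.
    by apply: (congr2 (fun x y => (x - y)%E)); apply/esym; exact: measure_addE.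
  rewrite -[LHS]/(nu A + c%:E * mu A)%E (jordan_decompE nu mA).
  exact: (fin_num_add_scale (fin_num_measure (jordan_pos (hahnP nu)) _ mA)
    (fin_num_measure (jordan_neg (hahnP nu)) _ mA)
    (fin_num_measure mu _ mA) cE).
Qed.

Lemma charge_integralD nu f g : bounded_measurable f -> bounded_measurable g ->
  charge_integral nu (fun x => f x + g x) =
  charge_integral nu f + charge_integral nu g.
Proof.
move=> bf bg; rewrite /charge_integral.
by rewrite !RintegralD//; first lra; exact: finite_measure_integrable.
Qed.

Lemma charge_integral_cst nu (c : R) :
  charge_integral nu (fun=> c) = c * fine (nu setT).
Proof.
rewrite /charge_integral !Rintegral_cst// jordan_decompE// fineB; first lra.
- exact: fin_num_measure.
- exact: fin_num_measure.
Qed.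

End charge_integral_linear.

(** * Iterated integrals against two charges *)

Section charge_integral_fubini.
Context d (T : measurableType d) (R : realType).
Implicit Types (nu la : {charge set T -> \bar R})
  (mu : {finite_measure set T -> \bar R}).
Variable K : T * T -> R.
Hypothesis bK : bounded_measurable K.

Lemma bounded_measurable_pair1 x : bounded_measurable (fun y => K (x, y)).
Proof.
have [mK [M KM]] := bK; split; last by exists M.
exact: measurableT_comp.
Qed.

Lemma bounded_measurable_pair2 y : bounded_measurable (fun x => K (x, y)).
Proof.
have [mK [M KM]] := bK; split; last by exists M.
exact: measurableT_comp.
Qed.

Lemma integrable_product (al be : {finite_measure set T -> \bar R}) :
  (al \x be)%E.-integrable setT (EFin \o K).
Proof.
apply: bounded_measurable_integrable => //.
rewrite -setXTT [ltLHS]product_measure1E// lte_mul_pinfty ?fin_num_measure//.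
exact: finite_measure_ltey.
Qed.

Lemma bounded_measurable_Rintegral mu :
  bounded_measurable (fun y => \int[mu]_x K (x, y)).
Proof.
have [mK [M KM]] := bK; split.
  apply: measurableT_comp => //.
  (* The partial integral in [x] is measurable in [y] whatever the measure put
     on the second factor; [mu] serves. *)
  exact: measurable_fubini_G (integrable_product mu mu).
exists (M * fine (mu setT)) => y.
have bKy := bounded_measurable_pair2 y.
apply: (le_trans (le_normr_Rintegral _ _)) => //.
  exact: finite_measure_integrable.
rewrite -Rintegral_cst//; apply: le_Rintegral => //.
- apply: (finite_measure_integrable mu); split; last first.
    by exists M => x; rewrite normr_id.
  by apply: measurableT_comp => //; exact: bKy.1.
- exact/finite_measure_integrable/bounded_measurable_cst.
Qed.

Lemma Rintegral_swap (al be : {finite_measure set T -> \bar R}) :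
  \int[be]_y \int[al]_x K (x, y) = \int[al]_x \int[be]_y K (x, y).
Proof.
rewrite /Rintegral; congr fine.
transitivity (\int[be]_y \int[al]_x (K (x, y))%:E)%E.
  apply: eq_integral => y _; rewrite fineK//; apply: integrable_fin_num => //.
  exact/finite_measure_integrable/bounded_measurable_pair2.
rewrite -(Fubini (integrable_product al be)).
apply: eq_integral => x _; rewrite fineK//; apply: integrable_fin_num => //.
exact/finite_measure_integrable/bounded_measurable_pair1.
Qed.

Lemma bounded_measurable_charge_integral nu :
  bounded_measurable (fun y => charge_integral nu (fun x => K (x, y))).
Proof.
apply: bounded_measurableD; last apply: bounded_measurableN;
  exact: bounded_measurable_Rintegral.
Qed.

End charge_integral_fubini.

(** Expanding both Jordan decompositions leaves four iterated integrals against
    finite measures, to each of which Fubini's theorem applies. *)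
Lemma charge_integral_swap d (T : measurableType d) (R : realType)
    (nu la : {charge set T -> \bar R}) (K : T * T -> R) :
  bounded_measurable K ->
  charge_integral la (fun y => charge_integral nu (fun x => K (x, y))) =
  charge_integral nu (fun x => charge_integral la (fun y => K (x, y))).
Proof.
move=> bK.
have bKs : bounded_measurable (fun z : T * T => K (z.2, z.1)).
  have [mK [M KM]] := bK; split; last by exists M => -[].
  exact: measurableT_comp mK (@measurable_swap _ _ T T).
rewrite /charge_integral.
do 2 (rewrite RintegralB//;
  try exact/finite_measure_integrable/bounded_measurable_Rintegral).
do 2 (rewrite [in RHS]RintegralB//;
  try exact/finite_measure_integrable/(bounded_measurable_Rintegral bKs)).
rewrite !(Rintegral_swap bK); ring.
Qed.

(** * Regularity of charges on compact metric spaces *)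

Section regularity.
Context (R : realType) (T : pointedMetricType R).
Implicit Types (m : {measure set (borel T) -> \bar R}) (A U C : set T).

Lemma open_borel U : open U -> measurable (U : set (borel T)).
Proof. by move=> oU; exact: sub_sigma_algebra. Qed.

Lemma closed_borel C : closed C -> measurable (C : set (borel T)).
Proof.
move=> cC; rewrite -(setCK C); apply: measurableC.
exact: (open_borel (closed_openC cC)).
Qed.

Lemma measure_small_tail m (D : nat -> set (borel T)) (e : \bar R) :
  (m setT < +oo)%E -> (forall n, measurable (D n)) -> nonincreasing_seq D ->
  (m (\bigcap_n D n) < e)%E -> exists n, (m (D n) < e)%E.
Proof.
move=> mfin mD niD small.
have cvgD : m \o D @ \oo --> m (\bigcap_n D n).
  apply: nonincreasing_cvg_mu => //; last exact: bigcapT_measurable.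
  by rewrite (le_lt_trans _ mfin)// le_measure ?inE.
have [n _ /(_ n (leqnn n)) /= ltn] :=
  cvgD _ (open_nbhs_nbhs (conj (@open_ereal_lt_ereal _ e) small)).
by exists n.
Qed.

(** Inner and outer regularity at [A] in one condition, with closed rather than
    compact inner sets: this form is symmetric under complementation. *)
Definition closed_open_approximable m A : Prop :=
  forall e : R, 0 < e -> exists C U, [/\ closed C, open U, C `<=` A, A `<=` U &
    (m (U `\` C : set (borel T)) < e%:E)%E].

(** Removing from [U] the points closer than [1/(n+1)] to its complement leaves
    closed sets that exhaust [U]. *)
Lemma open_approximable m U : (m setT < +oo)%E -> open U ->
  closed_open_approximable m U.
Proof.
move=> mfin oU e e0.
have npos n : 0 < n.+1%:R^-1 :> R by rewrite invr_gt0.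
pose D n := U `&` \bigcup_(z in ~` U) (ball z (n.+1%:R^-1 : R))°.
have oD n : open (\bigcup_(z in ~` U) (ball z (n.+1%:R^-1 : R))°).
  by apply: bigcup_open => z _; exact: open_interior.
have mD n : measurable (D n : set (borel T)).
  by apply: open_borel; exact: openI.
have niD : nonincreasing_seq D.
  move=> i j ij; apply/subsetPset => x [Ux [z Uz zx]]; split => //.
  exists z => //; apply: interiorS zx.
  by apply: le_ball; rewrite lef_pV2 ?posrE ?ltr0n// ler_nat ltnS.
have D0 : \bigcap_n D n = set0.
  rewrite -subset0 => x Dx; have [Ux _] := Dx 0%N I.
  have /nbhs_ballP[r /= r0 rU] : nbhs x U by exact: open_nbhs_nbhs.
  have [//|N] := @ltr_add_invr R 0 r; rewrite add0r => Nr.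
  have [_ [z Uz zx]] := Dx N I; apply: Uz; apply: rU.
  by apply: (le_ball (ltW Nr)); apply: ball_sym; exact: interior_subset.
have [|n mDn] := @measure_small_tail m D e%:E mfin mD niD.
  by rewrite D0 measure0 lte_fin.
exists (~` \bigcup_(z in ~` U) (ball z (n.+1%:R^-1 : R))°), U; split => //.
- exact: open_closedC.
- move=> x nx; apply: contrapT => Ux; apply: nx; exists x => //.
  exact: nbhsx_ballx.
- by rewrite setDE setCK.
Qed.

Lemma approximableC m A :
  closed_open_approximable m A -> closed_open_approximable m (~` A).
Proof.
move=> appA e e0; have [C [U [cC oU CA AU mUC]]] := appA e e0.
exists (~` U), (~` C); split.
- exact: open_closedC.
- exact: closed_openC.
- exact: subsetC.
- exact: subsetC.
- by rewrite setDE setCK setIC -setDE.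
Qed.

(** The union of the inner closed sets need not be closed. A finite subunion is,
    and the measure that it misses tends to the measure missed by the full
    union, which is at most [e/2]. *)
Lemma approximable_bigcup m (A : nat -> set T) : (m setT < +oo)%E ->
  (forall n, closed_open_approximable m (A n)) ->
  closed_open_approximable m (\bigcup_n A n).
Proof.
move=> mfin appA e e0.
(* These errors add up to [e/2], which leaves room for the strict bound [e]. *)
have d0 n : 0 < e / 2 / (2 ^ n.+1)%:R.
  by rewrite !divr_gt0// ltr0n expn_gt0.
have /choice[C /choice[U CU]] n := appA n _ (d0 n).
have mUC n : measurable (U n `\` C n : set (borel T)).
  have [cC oU _ _ _] := CU n.
  by apply: measurableD; [exact: open_borel | exact: closed_borel].
pose D n := \bigcup_k U k `\` \big[setU/set0]_(i < n) C i.
have cC n : closed (\big[setU/set0]_(i < n) C i).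
  by apply: closed_bigsetU => i _; have [] := CU i.
have oU : open (\bigcup_k U k) by apply: bigcup_open => k _; have [] := CU k.
have mD n : measurable (D n : set (borel T)).
  by apply: measurableD; [exact: open_borel | exact: closed_borel].
have niD : nonincreasing_seq D.
  move=> i j ij; apply/subsetPset => x [Ux nC]; split => //.
  move=> Cx; apply: nC; exact: (@subset_bigsetU _ C _ _ ij).
have DUC : \bigcap_n D n `<=` \bigcup_n (U n `\` C n).
  move=> x Dx; have [[n _ Un] _] := Dx 0%N I; exists n => //; split => // Cn.
  have [_] := Dx n.+1 I; apply; rewrite big_ord_recr/=; by right.
have [|n mDn] := @measure_small_tail m D e%:E mfin mD niD.
  apply: (@le_lt_trans _ _ (e / 2)%:E); last by rewrite lte_fin; lra.
  apply: le_trans (epsilon_trick0 xpredT (ltW _)); last by rewrite divr_gt0.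
  have mcapD := bigcapT_measurable mD.
  apply: le_trans (measure_sigma_subadditive m mUC mcapD DUC) _.
  apply: lee_nneseries => // n _; apply: ltW; by have [] := CU n.
exists (\big[setU/set0]_(i < n) C i), (\bigcup_k U k); split => //.
- rewrite -bigcup_mkord; apply: bigcup_sub => i _ x Cx; exists i => //.
  by have [_ _ CA _ _] := CU i; exact: CA.
- move=> x [i _ Ax]; exists i => //.
  by have [_ _ _ AU _] := CU i; exact: AU.
Qed.

(** The approximable sets form a sigma-algebra containing the open sets. *)
Lemma borel_approximable m A : (m setT < +oo)%E ->
  measurable (A : set (borel T)) -> closed_open_approximable m A.
Proof.
move=> mfin; apply: smallest_sub; last by move=> U; exact: open_approximable.
split.
- exact/open_approximable/open0.
- by move=> B; rewrite setTD; exact: approximableC.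
- by move=> B; exact: approximable_bigcup.
Qed.

(** The total variation is a finite Borel measure, so approximation by closed
    and open sets applies to it; compactness of the space turns the closed sets
    into compact ones. *)
Lemma charge_regular_compact (nu : {charge set (borel T) -> \bar R}) :
  compact [set: T] -> charge_regular nu.
Proof.
move=> cT A mA.
pose m : {measure set (borel T) -> \bar R} := charge_variation (hahnP nu).
have mE B : charge_total_variation nu B = m B by [].
have mfin : (m setT < +oo)%E.
  by rewrite -ge0_fin_numE// (fin_num_measure (charge_variation (hahnP nu))).
have app := borel_approximable mfin mA.
rewrite mE; split; apply/eqP; rewrite eq_le; apply/andP; split.
- apply: le_ereal_inf_tmp => _ [U [oU AU] <-]; rewrite mE.
  by rewrite le_measure ?inE//; exact: open_borel.
- apply/lee_addgt0Pr => e e0; have [C [U [cC oU CA AU mUC]]] := app e e0.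
  apply: (@le_trans _ _ (m U)); first by apply: ereal_inf_lbound; exists U.
  rewrite (_ : m U = m A + m (U `\` A))%E; last first.
    rewrite -measureU//; first by rewrite setDUK.
    - by apply: measurableD => //; exact: open_borel.
    - by rewrite setDIK.
  rewrite leeD2l// (le_trans _ (ltW mUC))// le_measure ?inE//.
  - by apply: measurableD => //; exact: open_borel.
  - by apply: measurableD; [exact: open_borel|exact: closed_borel].
  - exact: setDS.
- apply/lee_addgt0Pr => e e0; have [C [U [cC oU CA AU mUC]]] := app e e0.
  apply: (@le_trans _ _ (m C + e%:E)%E); last first.
    rewrite leeD2r//; apply: ereal_sup_ubound; exists C => //; split => //.
    exact: (subclosed_compact cC cT).
  rewrite (_ : m A = m C + m (A `\` C))%E; last first.
    rewrite -measureU//; first by rewrite setDUK.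
    - exact: closed_borel.
    - by apply: measurableD => //; exact: closed_borel.
    - by rewrite setDIK.
  rewrite leeD2l// (le_trans _ (ltW mUC))// le_measure ?inE//.
  - by apply: measurableD => //; exact: closed_borel.
  - by apply: measurableD; [exact: open_borel|exact: closed_borel].
  - exact: setSD.
- apply: ge_ereal_sup => _ [C [cC CA] <-]; rewrite mE.
  rewrite le_measure ?inE//; apply: closed_borel.
  exact: compact_closed (@metric_hausdorff _ T) cC.
Qed.

End regularity.

(** * Measurability of kernels *)

Section kernel.
Context (R : realType) (T : pointedMetricType R).
Hypothesis cT : compact [set: T].

(** A countable basis of [T] writes an open subset of the square as a countable
    union of open rectangles. Without one, the Borel sets of the square may
    escape the product sigma-algebra. *)
Lemma open_product_borel (W : set (T * T)) : open W ->
  measurable (W : set (borel T * borel T)).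
Proof.
move=> oW; have [B cB [oB nB]] := compact_second_countable cT.
(* The constant sequence of empty sets covers the case of an empty basis. *)
have [b ob Bb] : exists2 b : nat -> set T, (forall n, open (b n)) &
    forall U, B U -> exists n, b n = U.
  move/pfcard_geP: cB => [B0|[b]].
    by exists (fun=> set0) => [n|U]; [exact: open0|rewrite B0].
  exists b => [n|U BU]; first by apply: oB; exact: funS.
  by have [n _ <-] := 'surj_b BU; exists n.
rewrite (_ : W = \bigcup_n \bigcup_(k in [set k | b n `*` b k `<=` W])
    (b n `*` b k)); last first.
  apply/seteqP; split => [[x y] Wxy|z [n _ [k nkW /nkW]]//].
  have [[U V] /= [nU nV] UVW] : nbhs (x, y) W by exact: open_nbhs_nbhs.
  have [U' [/Bb[n <-] U'x] U'U] := nB x _ nU.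
  have [V' [/Bb[k <-] V'y] V'V] := nB y _ nV.
  exists n => //; exists k => // -[u v] [/= /U'U Uu /V'V Vv].
  exact: UVW.
apply: bigcupT_measurable => n; apply: bigcup_measurable => k _.
by apply: measurableX; exact: open_borel.
Qed.

Lemma kernel_bounded_measurable (K : T * T -> R) : continuous K ->
  bounded_measurable (K : borel T * borel T -> R).
Proof.
move=> cK; split.
  apply: (measurability _ (RGenOInfty.measurableE R)) => _ [_ [a ->] <-].
  rewrite setTI; apply: open_product_borel.
  by apply: open_comp; [move=> z _; exact: cK|exact: rray_open].
have cTT : compact [set: T * T] by rewrite -setXTT; exact: compact_setX.
have /compact_bounded[M [_ KM]] :=
  continuous_compact (continuous_subspaceT cK) cTT.
exists (M + 1) => z; apply: KM; first by rewrite ltrDl.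
by exists z.
Qed.

End kernel.

(** * Energy and the invariant measure *)

Section invariant_energy.
Context (R : realType) (T : pointedMetricType R).
Hypothesis cT : compact [set: T].
Variable K : T * T -> R.
Hypothesis kerK : is_kernel K.
Implicit Types (nu : {charge set (borel T) -> \bar R}).

Let bK : bounded_measurable (K : borel T * borel T -> R).
Proof.
case: kerK => cK _; exact: (kernel_bounded_measurable cT cK).
Qed.

Lemma energy_add_cst nu (C : R) :
  energy (fun p => K p + C) nu = energy K nu + C * fine (nu setT) ^+ 2.
Proof.
rewrite /energy.
under eq_fun => y.
  rewrite charge_integralD; last 2 first.
  - exact: (bounded_measurable_pair2 bK).
  - exact: bounded_measurable_cst.
  rewrite charge_integral_cst; over.
rewrite charge_integralD; last 2 first.
- exact: (bounded_measurable_charge_integral bK).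
- exact: bounded_measurable_cst.
rewrite charge_integral_cst; ring.
Qed.

Variable mu : probability (borel T) R.
Hypothesis inv_mu : invariant_measure K mu.

Local Notation muC := (charge_of_finite_measure mu).
Local Notation c := (energy K muC).

(** The projection of [nu] along [mu] onto the charges of mass zero. *)
Definition neutralize nu : {charge set (borel T) -> \bar R} :=
  cadd nu (cscale (- fine (nu setT)) muC).

Lemma neutralize_zero_mass nu : zero_mass (neutralize nu).
Proof.
have muT : muC setT = 1%E by exact: probability_setT.
have nuT : nu setT \is a fin_num by exact: fin_num_measure.
rewrite /zero_mass -[LHS]/(nu setT + (- fine (nu setT))%:E * muC setT)%E.
by rewrite muT mule1 EFinN fineK// subee.
Qed.

Lemma charge_integral_neutralize nu (f : borel T -> R) : bounded_measurable f ->
  charge_integral (neutralize nu) f =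
  charge_integral nu f - fine (nu setT) * charge_integral muC f.
Proof. by move=> bf; rewrite charge_integral_add_scale// mulNr. Qed.

Lemma potential_sym y : charge_integral muC (fun x : borel T => K (x, y)) = c.
Proof.
rewrite -(inv_mu y) /potential; congr charge_integral.
by apply/funext => x; exact: kerK.2.
Qed.

(** The inner integral against [mu] is constant by invariance and integrates to
    zero against a charge of mass zero, so only [nu] survives inside. Outside,
    the term in [mu] is computed by exchanging the integrals, which makes
    invariance available again. *)
Lemma energy_neutralize nu :
  energy K (neutralize nu) = energy K nu - c * fine (nu setT) ^+ 2.
Proof.
rewrite {1}/energy.
have -> : (fun y : borel T =>
      charge_integral (neutralize nu) (fun x : borel T => K (x, y))) =
    (fun y : borel T =>
      charge_integral nu (fun x : borel T => K (x, y)) + - (fine (nu setT) * c)).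
  apply/funext => y; rewrite charge_integral_neutralize ?potential_sym//.
  exact: (bounded_measurable_pair2 bK).
have bU := bounded_measurable_charge_integral bK nu.
rewrite charge_integralD//; last exact: bounded_measurable_cst.
rewrite charge_integral_cst neutralize_zero_mass mulr0 addr0.
rewrite charge_integral_neutralize// (charge_integral_swap nu muC bK).
have -> : (fun x : borel T =>
      charge_integral muC (fun y : borel T => K (x, y))) = (fun=> c).
  by apply/funext => x; exact: inv_mu.
rewrite charge_integral_cst /energy; ring.
Qed.

End invariant_energy.

Unset Implicit Arguments.
Set Strict Implicit.
Set Printing Implicit Defensive.

Theorem lemma3p7 (R : realType) (Omega : pointedMetricType R)
    (Omega_compact : compact [set: Omega])
    (K : Omega * Omega -> R) (kerK : is_kernel K)
    (ex_inv : exists mu : probability (borel Omega) R, invariant_measure K mu) :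
  (cond_pos_def K -> pos_def_up_to_constant K) /\
  (cond_strict_pos_def K -> strict_pos_def_up_to_constant K).
Proof.
have [mu inv_mu] := ex_inv.
set c := energy K (charge_of_finite_measure mu).
have energy_ge (nu : {charge set (borel Omega) -> \bar R}) :
    cond_pos_def K -> c * fine (nu setT) ^+ 2 <= energy K nu.
  move=> condK; rewrite -subr_ge0 -(energy_neutralize Omega_compact kerK inv_mu).
  apply: condK; [exact: charge_regular_compact|exact: neutralize_zero_mass].
split => [condK|[condK strictK]].
  exists (- c) => nu _; rewrite energy_add_cst//.
  by have := energy_ge nu condK; lra.
exists (1 - c); split => nu nu_reg; rewrite energy_add_cst//.
  by have := energy_ge nu condK; have := sqr_ge0 (fine (nu setT)); lra.
move=> energy0; have m0 : fine (nu setT) = 0.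
  apply/eqP; rewrite -sqrf_eq0; apply/eqP.
  by have := energy_ge nu condK; have := sqr_ge0 (fine (nu setT)); lra.
apply: strictK => //; last by move: energy0; rewrite m0; lra.
by rewrite /zero_mass -(fineK (fin_num_measure nu _ measurableT)) m0.
Qed.
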